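(* Let $H$ be a $(0,1,2)$-multigraph of order $n\ge 3$ with exactly two distinct main eigenvalues whose $B$-graph is the cycle $C_n$, and let $a,b$ be integers such that $a\,d(v)+b=s(v)$ for every $v\in V(H)$. Label the vertices as follows: if $n$ is even, $V(H)=\{u_1,\dots,u_{n/2},v_1,\dots,v_{n/2}\}$ with $u_1u_2\cdots u_{n/2}v_{n/2}\cdots v_2v_1u_1$ the cycle of the $B$-graph; if $n$ is odd, $V(H)=\{u_1,\dots,u_{(n-1)/2},v_1,\dots,v_{(n-1)/2},x\}$ with $u_1\cdots u_{(n-1)/2}\,x\,v_{(n-1)/2}\cdots v_1u_1$ the cycle; and assume $w(u_1,v_1)=2$. If $w(u_1,u_2)=1$ and $w(v_1,v_2)=2$, then $H$ is isomorphic to one of $U^3_{3t}$, $U^4_{5t}$, $U^5_{4t}$ for some $t\ge 1$.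
   Context: A $(0,1,2)$-multigraph $H$ is a loopless multigraph in which any two distinct vertices $u,v$ are joined by $w(u,v)\in\{0,1,2\}$ edges; its adjacency matrix has $(u,v)$-entry $w(u,v)$. The degree is $d(v)=\sum_u w(u,v)$ and $s(v)=\sum_{u\sim v}w(u,v)d(u)$. The $B$-graph of $H$ is the simple graph on $V(H)$ with $u\sim v$ iff $w(u,v)\ge1$. An eigenvalue of the adjacency matrix is main if its eigenspace is not orthogonal to the all-ones vector. For $n_1\ge1,n_2\ge0,t\ge1$, $[n_1,n_2]_t$ denotes the $(0,1,2)$-multigraph on $x_0,\dots,x_{N-1}$, $N=(n_1+n_2)t$, whose edges join $x_i$ and $x_{i+1\bmod N}$ with multiplicity $2$ if $(i\bmod(n_1+n_2))<n_1$ and $1$ otherwise (around the cycle: $n_1$ consecutive double edges then $n_2$ consecutive single edges, repeated $t$ times). $U^3_{3t}=[2,1]_t$, $U^4_{5t}=[3,2]_t$, $U^5_{4t}=[3,1]_t$. *)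

(* Defs.v *)
From HB Require Import structures.
From mathcomp Require Import all_boot all_order all_algebra.

Set Implicit Arguments.
Unset Strict Implicit.
Unset Printing Implicit Defensive.

Import GRing.Theory.

Record mgraph012 (V : finType) := MGraph012 {
  mult :> V -> V -> nat;
  mult_sym : forall u v, mult u v = mult v u;
  mult_loopless : forall v, mult v v = 0;
  mult_le2 : forall u v, mult u v <= 2
}.

Section Multigraph.

Variables (V : finType) (H : mgraph012 V).

Definition Bgraph : rel V := fun u v => 1 <= H u v.

Definition degree (v : V) : nat := \sum_(u : V) H u v.

Definition sdegree (v : V) : nat :=
  \sum_(u : V | Bgraph u v) H u v * degree u.

Definition adjmx (R : nzRingType) : 'M[R]_#|V| :=
  (\matrix_(i, j) (H (enum_val i) (enum_val j))%:R)%R.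

(* A listing of all the vertices that runs around a cycle of the B-graph; when
   the B-graph is the cycle graph, this is a traversal of that graph. *)
Definition Bcycle (c : seq V) : Prop :=
  ucycle Bgraph c /\ forall y : V, y \in c.

(* Indices start at 1.  For odd n the labels number (n-1)/2 on each side, and
   the index (n+1)/2 is conventionally given to x on both sides: this matters
   only for n = 3, where u_2 and v_2 then both denote x, the vertex that follows
   u_1, resp. v_1, on the cycle. *)
Definition cycle_labelling (u v : nat -> V) : Prop :=
  let k := #|V|./2 in
  let us := [seq u i | i <- iota 1 k] in
  let vs := [seq v i | i <- iota 1 k] in
  if odd #|V| then
    exists x : V, [/\ Bcycle (us ++ x :: rev vs), u k.+1 = x & v k.+1 = x]
  else Bcycle (us ++ rev vs).

End Multigraph.

(* The eigenvectors of MathComp's eigenspace are row vectors; for the symmetric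
   matrices considered here this makes no difference. *)
Definition main_eigenvalue (F : fieldType) (n : nat) (A : 'M[F]_n) (l : F) :=
  eigenvalue A l /\
  exists2 x : 'rV[F]_n, (x <= eigenspace A l)%MS & (\sum_i x ord0 i * 1 != 0)%R.

Definition exactly_two_main_eigenvalues (F : fieldType) (n : nat)
    (A : 'M[F]_n) : Prop :=
  exists l1 l2 : F, l1 <> l2 /\
    forall l : F, main_eigenvalue A l <-> l = l1 \/ l = l2.

Definition cycle_graph (n : nat) : rel 'I_n :=
  fun i j => (j == i.+1 %% n :> nat) || (i == j.+1 %% n :> nat).

(* Isomorphism of graphs (T = bool) and of multigraphs (T = nat), both given by
   their adjacency functions. *)
Definition isomorphic (T : Type) (V W : finType)
    (e : V -> V -> T) (f : W -> W -> T) : Prop :=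
  exists2 h : V -> W, bijective h & forall u v, f (h u) (h v) = e u v.

Definition edge_mult (n1 n2 i : nat) : nat :=
  if i %% (n1 + n2) < n1 then 2 else 1.

(* [n1, n2]_t, as a multiplicity function; the case analysis is meant for
   3 <= (n1 + n2) * t, where its two conditions exclude each other. *)
Definition cyc_mgraph (n1 n2 t : nat) (i j : 'I_((n1 + n2) * t)) : nat :=
  let N := (n1 + n2) * t in
  if j == i.+1 %% N :> nat then edge_mult n1 n2 i
  else if i == j.+1 %% N :> nat then edge_mult n1 n2 j
  else 0.

Definition U3 (t : nat) := @cyc_mgraph 2 1 t.
Definition U4 (t : nat) := @cyc_mgraph 3 2 t.
Definition U5 (t : nat) := @cyc_mgraph 3 1 t.

(* Main.v *)
Require Import Defs.
From HB Require Import structures.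
From mathcomp Require Import all_boot all_order all_algebra.
From mathcomp Require Import zify.

(** Read the multiplicities [e 0, e 1, ...] around the cycle.  The degree of the
    vertex between the edges [i+1] and [i+2] is [e (i+1) + e (i+2)], and the
    relation [a d + b = s] at that vertex determines [e (i+3)] from the three
    preceding multiplicities.  The vertices of degree 4 and 3 around the pattern
    [2, 2, 1] determine [a] and [b] from the two multiplicities adjacent to the
    pattern; one of the four cases is contradictory and the other three generate
    the periodic sequences of [[2,1]_t], [[3,2]_t] and [[3,1]_t].  Closing up
    after [n] edges forces the period to divide [n]. *)

Set Implicit Arguments.
Unset Strict Implicit.
Unset Printing Implicit Defensive.

(** * Multiplicity sequences around the cycle *)

Lemma edge_mult_period_dvd n1 n2 n : 0 < n1 -> 0 < n2 ->
  (forall i, edge_mult n1 n2 (i + n) = edge_mult n1 n2 i) -> n1 + n2 %| n.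
Proof.
move=> n1_gt0 n2_gt0 per; apply/eqP; set p := n1 + n2 in per *.
have p_gt0 : 0 < p by rewrite /p; lia.
have r_lt : n %% p < p by rewrite ltn_mod.
have := per 0; rewrite /edge_mult add0n -/p mod0n n1_gt0.
case: ifP => // r_lt1 _.
(* The last single edge of a block is shifted onto a double edge unless [n] is
   a multiple of the block length. *)
have := per p.-1; rewrite /edge_mult -/p (modn_small (_ : p.-1 < p)); last by lia.
have -> : (p.-1 < n1) = false by rewrite /p; lia.
rewrite -modnDmr; case: (posnP (n %% p)) => // r_gt0.
have -> : p.-1 + n %% p = (n %% p).-1 + p by lia.
by rewrite modnDr modn_small; [case: ifP => //; lia | lia].
Qed.

Definition main_relation (a b : int) (e : nat -> nat) : Prop := forall i,
  (a * (e i.+1 + e i.+2)%:Z + b =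
   (e i.+1 * (e i + e i.+1) + e i.+2 * (e i.+2 + e i.+3))%:Z)%R.

(** The coefficient of [e i.+3] in the relation is [e i.+2]; being positive, it cancels. *)
Lemma main_relation_unique (a b : int) (e e' : nat -> nat) :
  (forall i, 0 < e i) -> main_relation a b e -> main_relation a b e' ->
  e 0 = e' 0 -> e 1 = e' 1 -> e 2 = e' 2 -> e =1 e'.
Proof.
move=> e_gt0 rel rel' E0 E1 E2 i.
suff [] : [/\ e i = e' i, e i.+1 = e' i.+1 & e i.+2 = e' i.+2] by [].
elim: i => [|i [Ei Ei1 Ei2]]; split=> //.
have := e_gt0 i.+2; have := rel i; have := rel' i; rewrite -Ei -Ei1 -Ei2.
move=> -> [] /eqP; rewrite eqn_add2l => /eqP eq3 e2_gt0.
by move/eqP: eq3; rewrite eqn_pmul2l // eqn_add2l => /eqP.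
Qed.

(** Periodicity leaves finitely many instances to check, each by computation. *)
Lemma main_relation_edge_mult (a b : int) n1 n2 : 0 < n1 + n2 ->
  (forall i, i < n1 + n2 ->
    (a * (edge_mult n1 n2 i.+1 + edge_mult n1 n2 i.+2)%:Z + b =
     (edge_mult n1 n2 i.+1 * (edge_mult n1 n2 i + edge_mult n1 n2 i.+1) +
      edge_mult n1 n2 i.+2 * (edge_mult n1 n2 i.+2 + edge_mult n1 n2 i.+3))%:Z)%R)
  -> main_relation a b (edge_mult n1 n2).
Proof.
move=> p_gt0 rel i.
have em k : edge_mult n1 n2 (k + i) = edge_mult n1 n2 (k + i %% (n1 + n2)).
  by rewrite /edge_mult modnDmr.
have := rel (i %% (n1 + n2)); rewrite ltn_mod => /(_ p_gt0).
by rewrite -[_.+3]add3n -[_.+2]add2n -[_.+1]add1n -[X in _ * (_ X + _)]add0n -!em.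
Qed.

Lemma main_relation_classification (a b : int) (e : nat -> nat) :
  (forall i, 1 <= e i <= 2) -> main_relation a b e ->
  e 1 = 2 -> e 2 = 2 -> e 3 = 1 ->
  exists o, [\/ forall i, e (o + i) = edge_mult 2 1 i,
                forall i, e (o + i) = edge_mult 3 2 i
              | forall i, e (o + i) = edge_mult 3 1 i].
Proof.
move=> e12 rel e1 e2 e3.
have e_gt0 o i : 0 < e (o + i) by case/andP: (e12 (o + i)).
have rel_shift o : main_relation a b (fun i => e (o + i)).
  by move=> i; rewrite !addnS; apply: rel.
have := rel 0; have := rel 1; have := rel 2; rewrite e1 e2 e3.
case E0: (e 0) (e12 0) => [|[|[|?]]] // _;
  case E4: (e 4) (e12 4) => [|[|[|?]]] // _ r2 r1 r0.
(* For [e 0 = e 4 = 1] the first two relations give a = 2 and b = 6, and the third would force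
   [e 5 = 6]. *)
- have := e12 5; lia.
- have [aE bE] : (a = 1 /\ b = 8)%R by lia.
  (* As [e 0 = 1], the double edges start at index 1. In the next two cases [e 0 = 2]: both
     sequences begin 2, 2, 2 at index 0, and a, b tell them apart. *)
  exists 1; constructor 1.
  apply: (main_relation_unique (e_gt0 1) (rel_shift 1)) => //.
  by rewrite aE bE; apply: main_relation_edge_mult => // -[|[|[|]]].
- have [aE bE] : (a = 4 /\ b = - 2)%R by lia.
  exists 0; constructor 2.
  apply: (main_relation_unique (e_gt0 0) (rel_shift 0)) => //.
  by rewrite aE bE; apply: main_relation_edge_mult => // -[|[|[|[|[|]]]]].
- have [aE bE] : (a = 3 /\ b = 2)%R by lia.
  exists 0; constructor 3.
  apply: (main_relation_unique (e_gt0 0) (rel_shift 0)) => //.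
  by rewrite aE bE; apply: main_relation_edge_mult => // -[|[|[|[|]]]].
Qed.

(** * Closed walks around the B-graph *)

Lemma sum_support2 (V : finType) (F : V -> nat) (x y : V) :
  x != y -> (forall z, z != x -> z != y -> F z = 0) ->
  \sum_z F z = F x + F y.
Proof.
move=> neq_xy F0; rewrite (bigD1 x) //= (bigD1 y) 1?eq_sym //= big1 ?addn0 //.
by move=> z /andP[]; apply: F0.
Qed.

(** Each neighbour is the successor or the predecessor of [i], and both are unique; among three
    neighbours two lie on the same side, and these are not [j] and [k]. *)
Lemma cycle_graph_neighbours n (i j k l : 'I_n) :
  cycle_graph i j -> cycle_graph i k -> cycle_graph i l -> j != k ->
  (l == j) || (l == k).
Proof.
have succ_inj (x y : 'I_n) : x.+1 %% n = y.+1 %% n -> x = y.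
  move=> /eqP; rewrite -(addn1 x) -(addn1 y) eqn_modDr !modn_small // => /eqP.
  exact: val_inj.
rewrite /cycle_graph => ij ik il; apply: contraR; rewrite negb_or.
case/andP=> /negP lj /negP lk.
case/orP: ij => /eqP ij; case/orP: ik => /eqP ik; case/orP: il => /eqP il;
  try (by case: lj; apply/eqP/val_inj; rewrite /= ij il);
  try (by case: lk; apply/eqP/val_inj; rewrite /= ik il);
  try (by case: lj; apply/eqP/succ_inj; rewrite -il -ij);
  try (by case: lk; apply/eqP/succ_inj; rewrite -il -ik);
  by [apply/eqP/val_inj; rewrite /= ij ik | apply/eqP/succ_inj; rewrite -ij -ik].
Qed.

Section ClosedWalk.

Variables (V : finType) (H : mgraph012 V) (f : nat -> V).

Hypothesis card_ge3 : 3 <= #|V|.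
Hypothesis f_eq : forall i j, (f i == f j) = (i == j %[mod #|V|]).
Hypothesis f_adj : forall i z, Bgraph H z (f i.+1) = (z == f i) || (z == f i.+2).

(** Indexing by all of [nat] spares the relation a special case at the closing edge. *)
Let e i := H (f i) (f i.+1).

Lemma walk_neq2 i : f i != f i.+2.
Proof. rewrite f_eq -addn2 -{1}(addn0 i) eqn_modDl mod0n modn_small //. Qed.

Lemma walk_mult_eq0 i z : z != f i -> z != f i.+2 -> H z (f i.+1) = 0.
Proof.
move=> /negPf z0 /negPf z2; have := f_adj i z.
by rewrite z0 z2 /Bgraph; case: (H _ _).
Qed.

Lemma walk_mult_bounds i : 1 <= e i <= 2.
Proof. by rewrite mult_le2 andbT; have := f_adj i (f i); rewrite eqxx. Qed.

Lemma walk_degree i : degree H (f i.+1) = e i + e i.+1.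
Proof.
rewrite /degree (sum_support2 (walk_neq2 i)); last exact: walk_mult_eq0.
by rewrite /e (mult_sym H (f i.+2)).
Qed.

Lemma walk_periodic i : f (i + #|V|) = f i.
Proof. by apply/eqP; rewrite f_eq modnDr. Qed.

Lemma walk_sdegree i : sdegree H (f i.+2) =
  e i.+1 * (e i + e i.+1) + e i.+2 * (e i.+2 + e i.+3).
Proof.
rewrite /sdegree big_mkcond (sum_support2 (walk_neq2 i.+1)).
  by rewrite !f_adj !eqxx orbT /= !walk_degree /e (mult_sym H (f i.+3)).
by move=> z z1 z3; rewrite f_adj (negPf z1) (negPf z3).
Qed.

Lemma walk_main_relation (a b : int) :
  (forall y, (a * (degree H y)%:Z + b = (sdegree H y)%:Z)%R) ->
  main_relation a b e.
Proof. by move=> hab i; rewrite -walk_sdegree -walk_degree hab. Qed.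

(** The map sending [i] to [f (o + i)] is injective between sets of equal size, and its inverse is
    the isomorphism. *)
Lemma walk_isomorphic n1 n2 o : 0 < n1 -> 0 < n2 ->
  (forall i, e (o + i) = edge_mult n1 n2 i) ->
  exists2 t, 1 <= t & isomorphic H (@cyc_mgraph n1 n2 t).
Proof.
move=> n1_gt0 n2_gt0 eE.
have /dvdnP[t cardE] : n1 + n2 %| #|V|.
  apply: edge_mult_period_dvd => // i; rewrite -!eE /e addnA.
  by rewrite -addSn !walk_periodic.
exists t; first by move: card_ge3; rewrite cardE; case: (t).
have {}cardE : (n1 + n2) * t = #|V| by rewrite cardE mulnC.
pose g (i : 'I_((n1 + n2) * t)) := f (o + i).
have g_inj : injective g.
  move=> i j /eqP; rewrite f_eq eqn_modDl -cardE !modn_small // => /eqP.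
  exact: val_inj.
have [h gK hK] : bijective g by apply: inj_card_bij => //; rewrite card_ord cardE.
exists h; first by exists g.
move=> x y; rewrite -{2}(hK x) -{2}(hK y); move: (h x) (h y) => i j.
have next (k l : 'I_((n1 + n2) * t)) :
    (l == k.+1 %% ((n1 + n2) * t) :> nat) = (f (o + l) == f (o + k).+1).
  by rewrite f_eq -addnS eqn_modDl -cardE (modn_small (ltn_ord l)).
rewrite /cyc_mgraph !next /g; case: eqP => [->|/eqP ji]; first by rewrite -eE.
case: eqP => [->|/eqP ij]; first by rewrite -eE mult_sym.
(* Adjacency is known at successor indices only, and [o + j] may be 0, so a full period is added
   before stepping back. *)
have [k [kj kj1]] : exists k, f k.+1 = f (o + j) /\ f k.+2 = f (o + j).+1.
  exists (o + j + #|V|).-1.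
  have -> : (o + j + #|V|).-1.+1 = o + j + #|V| by lia.
  by rewrite -addSn !walk_periodic.
rewrite -kj walk_mult_eq0 // ?kj1 //; apply: contra ji => /eqP ik.
rewrite -kj; move/eqP: ik.
by rewrite !f_eq -(addn1 k) -(addn1 (o + i)) eqn_modDr eq_sym.
Qed.

End ClosedWalk.

(** * From a labelling to a closed walk *)

Lemma nth_labelling (T : Type) (u v : nat -> T) x0 p q :
  let c := [seq u i | i <- iota 1 p] ++ rev [seq v i | i <- iota 1 q] in
  (forall i, i < p -> nth x0 c i = u i.+1) /\
  (forall i, i < q -> nth x0 c (size c - i.+1) = v i.+1).
Proof.
split=> i lti; rewrite nth_cat ?size_map ?size_iota.
  by rewrite lti (nth_map 0) ?size_iota // nth_iota.
rewrite size_cat size_rev !size_map !size_iota.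
case: ifP => [|_]; first by lia.
rewrite nth_rev ?size_map ?size_iota; last by lia.
have -> : q - (p + q - i.+1 - p).+1 = i by lia.
by rewrite (nth_map 0) ?size_iota // nth_iota.
Qed.

(* Moving [x] to the end of the list of the u's, resp. v's, makes [u 2], resp.
   [v 2], a member of that list also when n = 3. *)
Lemma labelling_Bcycle (V : finType) (H : mgraph012 V) (u v : nat -> V) :
  3 <= #|V| -> cycle_labelling H u v ->
  exists2 c, Bcycle H c &
    [/\ size c = #|V|, nth (u 1) c 0 = u 1, nth (u 1) c 1 = u 2,
        nth (u 1) c (#|V| - 1) = v 1 & nth (u 1) c (#|V| - 2) = v 2].
Proof.
move=> card_ge3.
have size_c c : Bcycle H c -> size c = #|V|.
  move=> [/andP[_ c_uniq] c_all]; rewrite -(card_uniqP c_uniq).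
  by apply/eq_card => y; rewrite c_all.
rewrite /cycle_labelling; set k := #|V|./2.
case: ifP => odd_V => [[x [cyc ux vx]] | cyc].
- exists (map u (iota 1 k) ++ x :: rev (map v (iota 1 k))); first by [].
  have k1 : 1 <= k by rewrite /k; lia.
  have cu : map u (iota 1 k) ++ x :: rev (map v (iota 1 k)) =
            map u (iota 1 k.+1) ++ rev (map v (iota 1 k)).
    by rewrite -[k.+1]addn1 iotaD map_cat /= add1n ux -catA.
  have cv : map u (iota 1 k) ++ x :: rev (map v (iota 1 k)) =
            map u (iota 1 k) ++ rev (map v (iota 1 k.+1)).
    by rewrite -[in RHS](addn1 k) iotaD map_cat rev_cat /= add1n vx.
  have sz := size_c _ cyc.
  have [nu _] := nth_labelling u v (u 1) k.+1 k.
  have [_ nv] := nth_labelling u v (u 1) k k.+1.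
  rewrite -cu in nu; rewrite -cv sz in nv.
  by split=> //; [exact: (nu 0) | exact: (nu 1) | exact: (nv 0) | exact: (nv 1)].
- exists (map u (iota 1 k) ++ rev (map v (iota 1 k))); first by [].
  have k1 : 2 <= k by rewrite /k; lia.
  have sz := size_c _ cyc.
  have [nu nv] := nth_labelling u v (u 1) k k; rewrite sz in nv.
  by split=> //; [apply: (nu 0) | apply: (nu 1) | apply: (nv 0) | apply: (nv 1)];
    lia.
Qed.

Section TraversalWalk.

Variables (V : finType) (H : mgraph012 V) (x0 : V) (c : seq V).

Hypothesis card_ge3 : 3 <= #|V|.
Hypothesis size_c : size c = #|V|.
Hypothesis c_cycle : Bcycle H c.
Hypothesis B_cycle : isomorphic (Bgraph H) (@cycle_graph #|V|).

Let f i := nth x0 c (i %% #|V|).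

Lemma traversal_eq i j : (f i == f j) = (i == j %[mod #|V|]).
Proof.
have [/andP[_ c_uniq] _] := c_cycle.
by rewrite nth_uniq // size_c ltn_mod; lia.
Qed.

Lemma traversal_step i : Bgraph H (f i) (f i.+1).
Proof.
have [/andP[c_path _] _] := c_cycle.
have i_lt : i %% #|V| < #|V| by rewrite ltn_mod; lia.
rewrite /f -(addn1 i) -modnDml addn1; move: (i %% _) i_lt => {}i i_lt.
case: c c_path size_c => [|y s].
  by move=> _ sz; move: card_ge3; rewrite -sz.
move=> /(pathP x0) s_path; rewrite [size _]/= => sz; have := s_path i.
rewrite size_rcons sz -rcons_cons !nth_rcons /= sz i_lt => /(_ isT).
(* Before the last position the step stays inside the list; at [i = size s] it is the closing edge
   back to [y]. *)
have [lt_is|] := ltnP i (size s).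
  by rewrite modn_small // -sz ltnS.
move=> le_si; have -> : i = size s.
  by apply/eqP; rewrite eqn_leq le_si -ltnS sz i_lt.
by rewrite eqxx sz modnn.
Qed.

(** A traversal by itself could leave chords. The steps before and after [f i.+1] give it two
    distinct neighbours, and the cycle graph has room for no third. *)
Lemma traversal_adj i z :
  Bgraph H z (f i.+1) = (z == f i) || (z == f i.+2).
Proof.
have Bsym y w : Bgraph H y w = Bgraph H w y by rewrite /Bgraph mult_sym.
apply/idP/orP => [zi | [] /eqP ->]; last 2 first.
- exact: traversal_step.
- by rewrite Bsym traversal_step.
have [h /bij_inj h_inj hE] := B_cycle.
have := @cycle_graph_neighbours _ (h (f i.+1)) (h (f i)) (h (f i.+2)) (h z).
rewrite !hE !(inj_eq h_inj) (Bsym _ (f i)) !traversal_step (Bsym _ z).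
move=> /(_ isT isT zi) nb; apply/orP/nb.
by apply: walk_neq2 => //; exact: traversal_eq.
Qed.

End TraversalWalk.

Theorem theorem3p6 (R : rcfType) (V : finType) (H : mgraph012 V)
  (hn : 3 <= #|V|)
  (hmain : exactly_two_main_eigenvalues (adjmx H R))
  (hB : isomorphic (Bgraph H) (@cycle_graph #|V|))
  (a b : int)
  (hab : forall y : V, (a * (degree H y)%:Z + b = (sdegree H y)%:Z)%R)
  (u v : nat -> V)
  (huv : cycle_labelling H u v)
  (h11 : H (u 1) (v 1) = 2)
  (hu : H (u 1) (u 2) = 1)
  (hv : H (v 1) (v 2) = 2) :
  exists t : nat, 1 <= t /\
    (isomorphic H (@U3 t) \/ isomorphic H (@U4 t) \/ isomorphic H (@U5 t)).
Proof.
have [c c_cycle [size_c c0 c1 cn1 cn2]] := labelling_Bcycle hn huv.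
(* The shift puts v_2, v_1, u_1, u_2 at the positions 1, 2, 3, 4. *)
pose f i := nth (u 1) c ((i + (#|V| - 3)) %% #|V|).
have f_eq i j : (f i == f j) = (i == j %[mod #|V|]).
  by rewrite /f (traversal_eq _ hn size_c c_cycle) eqn_modDr.
have f_adj i z : Bgraph H z (f i.+1) = (z == f i) || (z == f i.+2).
  by rewrite /f !addSn; apply: traversal_adj.
have f1 : f 1 = v 2 by rewrite /f modn_small -?cn2; [congr nth|]; lia.
have f2 : f 2 = v 1 by rewrite /f modn_small -?cn1; [congr nth|]; lia.
have f3 : f 3 = u 1 by rewrite /f subnKC // modnn.
have f4 : f 4 = u 2.
  by rewrite /f -[4]/(1 + 3) -addnA subnKC // modnDr modn_small //; lia.
have := main_relation_classification (walk_mult_bounds f_adj)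
  (walk_main_relation hn f_eq f_adj hab).
rewrite f1 f2 f3 f4 mult_sym hv mult_sym h11 hu => /(_ erefl erefl erefl) [o].
by case=> /(walk_isomorphic hn f_eq f_adj) [] // t t_gt0 iso; exists t; tauto.
Qed.
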